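(* Let $q$ be a prime power, let $n\ge 4$ be an integer, and put $k=\mathbb{F}_{q^{2n}}$. Let $c\in k^*$ with $c^{q^n}=-c$, and let $F=k(u,z)$ be the function field of $\mathcal{X}_{q,n}$, given by $$z^{q^n+1}=c\,(u^q-u)\bigl(1+(u^q-u)^{q-1}\bigr)^{\frac{q^{n-1}-1}{q-1}}.$$ For $M=\begin{pmatrix}\alpha&\beta\\ \gamma&\delta\end{pmatrix}\in\mathrm{GL}_2(q)$ and $\lambda\in k^*$ with $\lambda^{q^n+1}=\det M$, the assignments $$\sigma_{M,\lambda}(u)=\frac{\alpha u+\beta}{\gamma u+\delta},\qquad \sigma_{M,\lambda}(z)=\frac{\lambda z}{\gamma u+\delta}$$ define $k$-automorphisms of $F$. These automorphisms $\sigma_{M,\lambda}$ form a subgroup of $\mathrm{Aut}(\mathcal{X}_{q,n})$ of order $(q^n+1)q(q^2-1)$.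
   Context: $\mathcal{X}_{q,n}$ is the nonsingular projective curve over $k$ with function field $F=k(u,z)$, where $[F:k(u)]=q^n+1$ (the defining polynomial is absolutely irreducible). $\mathrm{GL}_2(q)$ is the group of invertible $2\times 2$ matrices over $\mathbb{F}_q$. $\mathrm{Aut}(\mathcal{X}_{q,n})$ is the automorphism group of $\mathcal{X}_{q,n}$, identified with the group of $k$-automorphisms of $F$. *)

(* Defs.v *)
From HB Require Import structures.
From mathcomp Require Import all_boot all_order all_algebra all_fingroup all_field.
From mathcomp Require Import boolp classical_sets functions cardinality.

Set Implicit Arguments.
Unset Strict Implicit.
Unset Printing Implicit Defensive.

Import GRing.Theory.
Local Open Scope ring_scope.

(* The group Aut_k(F) of a field F seen as a k-algebra through i : k -> F,
   with composition as product.  Automorphisms are unbundled functions in a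
   subtype, so that equality of automorphisms is equality of functions. *)
Section KAutomorphisms.
Variables (k F : fieldType) (i : {rmorphism k -> F}).

Definition is_kaut (s : F -> F) : Prop :=
  [/\ zmod_morphism s, monoid_morphism s, bijective s
    & forall a : k, s (i a) = i a].

Record kaut := KAut { kaut_fun :> F -> F; _ : `[< is_kaut kaut_fun >] }.

HB.instance Definition _ := [isSub for kaut_fun].
HB.instance Definition _ := [Choice of kaut by <:].

Lemma kautP (s : kaut) : is_kaut s.
Proof. by case: s => s /= /asboolP. Qed.

Lemma kaut_eqP (s t : kaut) : s =1 t -> s = t.
Proof. by move=> st; apply/val_inj/funext. Qed.

Lemma is_kaut_id : is_kaut idfun.
Proof. by split=> //; exists idfun. Qed.

Lemma is_kaut_comp (s t : kaut) : is_kaut (s \o t).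
Proof.
have [sB [s1 sM] sbij si] := kautP s; have [tB [t1 tM] tbij ti] := kautP t.
split; last by move=> a /=; rewrite ti si.
- by move=> x y /=; rewrite tB sB.
- by split=> [|x y] /=; rewrite ?t1 ?s1 // tM sM.
- exact: bij_comp.
Qed.

Lemma kaut_inv_subproof (s : kaut) :
  {t : F -> F | is_kaut t & cancel s t /\ cancel t s}.
Proof.
apply: cid2; have [sB [s1 sM] [t sK tK] si] := kautP s; exists t => //.
have s_inj := can_inj sK.
split; last by move=> a; apply: s_inj; rewrite tK si.
- by move=> x y; apply: s_inj; rewrite sB !tK.
- by split=> [|x y]; apply: s_inj; rewrite ?sM !tK ?s1.
- by exists s.
Qed.

Definition kaut_one : kaut := KAut (asboolT is_kaut_id).
Definition kaut_mul (s t : kaut) : kaut := KAut (asboolT (is_kaut_comp s t)).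
Definition kaut_inv (s : kaut) : kaut :=
  KAut (asboolT (s2valP (kaut_inv_subproof s))).

Lemma kaut_mulA : associative kaut_mul.
Proof. by move=> s t r; apply: kaut_eqP. Qed.

Lemma kaut_mul1 : left_id kaut_one kaut_mul.
Proof. by move=> s; apply: kaut_eqP. Qed.

Lemma kaut_mulr1 : right_id kaut_one kaut_mul.
Proof. by move=> s; apply: kaut_eqP. Qed.

Lemma kaut_mulV : left_inverse kaut_one kaut_inv kaut_mul.
Proof.
by move=> s; apply: kaut_eqP => x /=; case: (s2valP' (kaut_inv_subproof s)) => ->.
Qed.

Lemma kaut_mulrV : right_inverse kaut_one kaut_inv kaut_mul.
Proof.
by move=> s; apply: kaut_eqP => x /=; case: (s2valP' (kaut_inv_subproof s)) => _ ->.
Qed.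

HB.instance Definition _ := isGroup.Build kaut
  kaut_mulA kaut_mul1 kaut_mulr1 kaut_mulV kaut_mulrV.

End KAutomorphisms.

(* A finite extension F of k(u) = Frac(k[X]), viewed over k. *)
Section FunctionField.
Variables (k : finFieldType) (F : fieldExtType {fraction {poly k}}).

Definition ratvar : F := (tofrac ('X : {poly k}))%:A.

Definition constF : {rmorphism k -> F} :=
  in_alg F \o tofrac (R := {poly k}) \o polyC.

(* q - 1 divides q ^ (n - 1) - 1, so the nat quotient is the exact exponent. *)
Definition curve_eq (q n : nat) (c : k) (z : F) : Prop :=
  let w := ratvar ^+ q - ratvar in
  z ^+ (q ^ n + 1) =
    constF c * w * (1 + w ^+ (q - 1)) ^+ ((q ^ (n - 1) - 1) %/ (q - 1)).

(* j identifies Fq, of order q, with the subfield F_q of k. *)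
Variables (Fq : finFieldType) (j : {rmorphism Fq -> k}).

Definition sigma_param (q n : nat) (M : {'GL_2[Fq]}) (lambda : k) : Prop :=
  lambda != 0 /\ lambda ^+ (q ^ n + 1) = j (\det (GLval M)).

Definition sigma_spec (z : F) (M : {'GL_2[Fq]}) (lambda : k)
    (s : kaut constF) : Prop :=
  let entry (a b : 'I_2) : F := constF (j (GLval M a b)) in
  let alpha := entry 0 0 in let beta := entry 0 1 in
  let gamma := entry 1 0 in let delta := entry 1 1 in
  s ratvar = (alpha * ratvar + beta) / (gamma * ratvar + delta) /\
  s z = constF lambda * z / (gamma * ratvar + delta).

Definition sigmas (q n : nat) (z : F) : set (kaut constF) :=
  [set s | exists M lambda, sigma_param q n M lambda /\ sigma_spec z M lambda s].

End FunctionField.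

(* Main.v *)
Require Import Defs.
From HB Require Import structures.
From mathcomp Require Import all_boot all_order all_algebra all_fingroup all_field.
From mathcomp Require Import boolp classical_sets functions cardinality.
From mathcomp Require Import ring.

(* Write [E] for the right-hand side of the curve equation and [N = q^n + 1].
   [E] has a simple zero at [u = 0], so a valuation argument gives
   [[F : k(u)] = N]: a relation between [u] and [z] over [k] is a multiple of
   [T^N - E], and any point [(x, y)] of the curve in [F] with [x]
   transcendental over [k] defines an endomorphism [u |-> x], [z |-> y].
   With [D = gamma u + delta], the Moebius map given by [M] multiplies
   [u^q - u] by [det M / D^(q+1)] and [u^(q^2) - u] by [det M / D^(q^2+1)],
   hence [E] by [det M / D^N]; this is the condition [lambda^N = det M].  The
   composition law for the pairs [(M, lambda)] provides inverses.  Finally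
   two pairs induce the same automorphism iff they differ by a scalar of
   [F_q^*], and each value of [det M] has [N] roots [lambda], so there are
   [N * |GL_2(q)| / (q - 1)] automorphisms. *)

Set Implicit Arguments.
Unset Strict Implicit.
Unset Printing Implicit Defensive.

Import GRing.Theory.
Local Open Scope ring_scope.
Local Open Scope card_scope.

(** * The degree of [z] over [k(u)] *)

Lemma fraction_divP (R : idomainType) (x : {fraction R}) :
  exists a b : R, b != 0 /\ x = tofrac a / tofrac b.
Proof.
elim/generic_quotient.quotW: x => r; exists r.1, r.2; split; first exact: denom_ratioP.
have d0 : tofrac r.2 != 0 by rewrite tofrac_eq0 denom_ratioP.
apply: (mulIf d0); rewrite divfK //; unlock FracField.tofrac.
rewrite -[LHS](FracField.pi_mul r (Ratio r.2 1)); apply/eqmodP.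
rewrite /= FracField.equivfE /FracField.mulf.
rewrite !numden_Ratio ?mulr1 ?oner_neq0 ?denom_ratioP //.
by rewrite mulrC.
Qed.

(* [b] is the determinant of the companion matrix of [P], i.e. up to sign the
   norm of a root of [P]. *)
Lemma dvdp_XnsubC_norm (K : fieldType) (P : {poly K}) (N : nat) (a : K) :
  P \is monic -> P %| 'X^N - a%:P -> exists b : K, b ^+ N = a ^+ (size P).-1.
Proof.
move=> Pm PN; case d_def: (size P).-1 => [|d].
  by exists 1; rewrite expr1n expr0.
have := companionmxK Pm; move: (companionmx P); rewrite d_def => C Cchar.
(* [P] is the characteristic polynomial of [C], so Cayley-Hamilton kills every multiple of [P] at
   [C]. *)
have CN : C ^+ N = a%:M.
  apply/eqP; rewrite -subr_eq0; apply/eqP; case/dvdpP: PN => Q QP.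
  have := congr1 (horner_mx C) QP.
  by rewrite rmorphB rmorphXn /= horner_mx_X horner_mx_C => ->;
     rewrite rmorphM /= -Cchar Cayley_Hamilton mulr0.
by exists (\det C); rewrite -(det_scalar d.+1 a) -CN; elim: (N) => [|m IHm];
   rewrite ?expr0 ?det1 // !exprS IHm det_mulmx.
Qed.

Section RadicalDegree.
Variables (k : fieldType) (N : nat) (E : {poly k}).
Hypotheses (E_neq0 : E != 0) (mupE : mup 0 E = 1%N).

Lemma mupXn (x : k) (P : {poly k}) n : P != 0 -> mup x (P ^+ n) = (n * mup x P)%N.
Proof.
move=> P0; elim: n => [|n IHn]; first by rewrite expr0 mupNroot // root1.
by rewrite exprS mupM ?expf_neq0 // IHn mulSn.
Qed.

(** With [b = r / s], comparing orders of vanishing at 0 in [r ^+ N = E ^+ d * s ^+ N] gives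
    [N * mup 0 r = d + N * mup 0 s]. *)
Lemma dvdn_frac_root (b : {fraction {poly k}}) d :
  b ^+ N = tofrac E ^+ d -> (N %| d)%N.
Proof.
have [N0|N0] := eqVneq N 0%N.
  rewrite N0 expr0 -tofracXn -tofrac1 => /eqP; rewrite tofrac_eq => /eqP E1.
  by have := mupXn 0 d E_neq0; rewrite -E1 mupE muln1 mupNroot ?root1 // => <-.
have [r [s [s0 ->]]] := fraction_divP b.
have fs0 : tofrac s ^+ N != 0 by rewrite expf_neq0 ?tofrac_eq0.
rewrite expr_div_n => /(canRL (divfK fs0)); rewrite -!tofracXn -tofracM.
move/eqP; rewrite tofrac_eq => /eqP rE.
have r0 : r != 0.
  apply: contra_eq_neq rE => ->; rewrite expr0n (negPf N0) eq_sym.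
  by rewrite mulf_neq0 ?expf_neq0.
have := congr1 (mup 0) rE; rewrite mupM ?expf_neq0 // !mupXn // mupE muln1.
move=> h; have := dvdn_mulr (mup 0 r) (dvdnn N).
by rewrite h dvdn_addl // dvdn_mulr.
Qed.

Variables (L : fieldExtType {fraction {poly k}}) (z : L).
Hypothesis zN : z ^+ N = (tofrac E)%:A.

(** Up to sign, the norm [b] of [z] satisfies [b ^+ N = E ^+ d], where [d > 0] is the degree of the
    minimal polynomial; hence [N] divides [d]. *)
Lemma leq_adjoin_degree : (N <= adjoin_degree 1 z)%N.
Proof.
have /polyOver1P[P PE] := minPolyOver 1 z.
have Pm : P \is monic by rewrite -(map_monic (in_alg L)) -PE monic_minPoly.
have PN : P %| 'X^N - (tofrac E)%:P.
  rewrite -(dvdp_map (in_alg L)) -PE minPoly_dvdp ?alg_polyOver //.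
  by rewrite rmorphB /= map_polyXn map_polyC /root !hornerE zN subrr.
have [b /dvdn_frac_root Nd] := dvdp_XnsubC_norm Pm PN.
have -> : adjoin_degree 1 z = (size P).-1.
  by rewrite -(size_map_poly (in_alg L)) -PE size_minPoly.
apply: dvdn_leq Nd; rewrite -ltnS -(size_map_poly (in_alg L)) -PE size_minPoly.
by rewrite /= ltnS.
Qed.

(** Linear independence of the powers of [z] below [N]: the minimal polynomial, of degree at least
    [N], divides any relation. *)
Lemma radical_free (r : {poly {poly k}}) : (size r <= N)%N ->
  (map_poly (in_alg L \o @tofrac _) r).[z] = 0 -> r = 0.
Proof.
move=> sr r0; apply/eqP/negPn/negP => rn0.
have inj : injective (in_alg L \o @tofrac {poly k}).
  by move=> x y /fmorph_inj/eqP; rewrite tofrac_eq => /eqP.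
have /minPoly_dvdp/(_ (introT eqP r0)) :
    map_poly (in_alg L \o @tofrac {poly k}) r \is a polyOver 1%VS.
  by rewrite map_poly_comp; apply: alg_polyOver.
have mr0 : map_poly (in_alg L \o @tofrac {poly k}) r != 0.
  rewrite map_poly_eq0_id0 // -(rmorph0 (in_alg L \o @tofrac {poly k})).
  by rewrite (inj_eq inj) lead_coef_eq0.
move/(dvdp_leq mr0); rewrite size_minPoly size_map_inj_poly ?rmorph0 //.
by move/leq_trans/(_ sr); rewrite ltnNge leq_adjoin_degree.
Qed.
End RadicalDegree.

(** * Endomorphisms from points of the curve *)

(** As [ker f] lies in [ker g], [g] factors through the image of [f]; it extends to all of [F]
    because each element is a quotient whose denominator survives under [g]. *)
Lemma rmorph_extend_frac (A : comNzRingType) (F G : fieldType)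
    (f : {rmorphism A -> F}) (g : {rmorphism A -> G}) :
    (forall a, f a = 0 -> g a = 0) ->
    (forall x, exists a b, g b != 0 /\ x * f b = f a) ->
  exists s : F -> G,
    [/\ zmod_morphism s, monoid_morphism s & forall a, s (f a) = g a].
Proof.
move=> fg0 frac.
have [nd ndP] : {nd : F -> A * A &
    forall x, g (nd x).2 != 0 /\ x * f (nd x).2 = f (nd x).1}.
  apply: (@choice _ _ (fun x ab => g ab.2 != 0 /\ x * f ab.2 = f ab.1)) => x.
  by have [a [b ?]] := frac x; exists (a, b).
pose num x := (nd x).1; pose den x := (nd x).2.
pose s x := g (num x) / g (den x).
(* Independence of the chosen fraction: cross-multiplying two fractions for [x] gives an element of
   [ker f], hence of [ker g]. *)
have sP x a b : g b != 0 -> x * f b = f a -> s x = g a / g b.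
  move=> gb xb; have [gd xd] := ndP x; apply/eqP; rewrite eqr_div // -!rmorphM.
  rewrite -subr_eq0 -rmorphB fg0 // rmorphB !rmorphM -xd -xb; apply/eqP.
  by rewrite subr_eq0 mulrAC.
have fn x : f (num x) = x * f (den x) by have [] := ndP x.
have gd x : g (den x) != 0 by have [] := ndP x.
exists s; split.
- move=> x y; rewrite (sP (x - y) (num x * den y - num y * den x) (den x * den y)).
  + rewrite rmorphB !rmorphM /s; field; first by rewrite !gd.
  + by rewrite rmorphM mulf_neq0.
  + by rewrite rmorphB !rmorphM !fn; ring.
- split=> [|x y]; first by rewrite (sP 1 1 1) ?rmorph1 ?mulr1 ?divr1 ?oner_neq0.
  rewrite (sP (x * y) (num x * num y) (den x * den y)).
  + by rewrite !rmorphM /s mulf_div.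
  + by rewrite rmorphM mulf_neq0.
  + by rewrite !rmorphM !fn; ring.
- by move=> a; rewrite (sP _ a 1) ?rmorph1 ?mulr1 ?divr1 ?oner_neq0.
Qed.

Lemma horner_map_MXaddC (R : nzSemiRingType) (S : comNzSemiRingType)
    (f : {rmorphism R -> S}) (p : {poly R}) c x :
  (map_poly f (p * 'X + c%:P)).[x] = (map_poly f p).[x] * x + f c.
Proof. by rewrite rmorphD rmorphM /= map_polyX map_polyC hornerMXaddC. Qed.

Section BivariateEvaluation.
Variables (k : comNzRingType) (F : fieldType) (C : {rmorphism k -> F}).

(** The inner variable goes to [x] and the outer one to [y]. *)
Definition biv_eval (x y : F) : {rmorphism {poly {poly k}} -> F} :=
  horner_eval y \o map_poly (horner_eval x \o map_poly C).

Lemma biv_evalC x y p : biv_eval x y p%:P = (map_poly C p).[x].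
Proof. by rewrite /biv_eval /= map_polyC /horner_eval hornerC. Qed.

Lemma biv_evalX x y : biv_eval x y 'X = y.
Proof. by rewrite /biv_eval /= map_polyX /horner_eval hornerX. Qed.

Lemma biv_eval_rmorph (s : F -> F) x y a :
    zmod_morphism s -> monoid_morphism s -> (forall c, s (C c) = C c) ->
  s (biv_eval x y a) = biv_eval (s x) (s y) a.
Proof.
move=> sB sM sC.
pose sZ := GRing.isZmodMorphism.Build _ _ s sB.
pose sm := GRing.isMonoidMorphism.Build _ _ s sM.
pose S : {rmorphism F -> F} := HB.pack s sZ sm.
rewrite /biv_eval /= /horner_eval -[s]/(S : F -> F).
rewrite -horner_map -map_poly_comp; congr (_ .[ _]); apply: eq_map_poly => p /=.
rewrite /horner_eval -[s]/(S : F -> F) -horner_map -map_poly_comp; congr (_ .[ _]).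
by apply: eq_map_poly => c /=; apply: sC.
Qed.
End BivariateEvaluation.

Section RadicalExtension.
Variables (k : finFieldType) (F : fieldExtType {fraction {poly k}}) (z : F).
Variables (N : nat) (E : {poly k}).
Hypotheses (E_neq0 : E != 0) (mupE : mup 0 E = 1%N) (N_gt0 : (0 < N)%N).
Hypothesis F_gen : <<1; z>>%VS = fullv.
Hypothesis zN : z ^+ N = (tofrac E)%:A.

Local Notation C := (constF F).
Local Notation u := (ratvar F).

Lemma horner_ratvar (p : {poly k}) : (map_poly C p).[u] = (tofrac p)%:A.
Proof.
rewrite -[RHS]/((in_alg F \o @tofrac _) p).
elim/poly_ind: p => [|p c IHp]; first by rewrite map_poly0 horner0 rmorph0.
rewrite horner_map_MXaddC IHp.
by rewrite [in RHS]rmorphD [in RHS]rmorphM.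
Qed.

Lemma biv_eval_ratvar a :
  biv_eval C u z a = (map_poly (in_alg F \o @tofrac _) a).[z].
Proof.
rewrite /biv_eval /= /horner_eval; congr (_ .[_]); apply: eq_map_poly => p /=.
by rewrite /horner_eval horner_ratvar.
Qed.

Lemma ratvar_transcendental p : p != 0 -> (map_poly C p).[u] != 0.
Proof. by rewrite horner_ratvar scaler_eq0 oner_eq0 orbF tofrac_eq0. Qed.

(** Division of [a] by the monic [P] leaves a remainder of degree below [N], which is zero by
    [radical_free]; so [a] is a multiple of [P] and vanishes at every point of the curve. *)
Lemma biv_eval_specialize a x y : y ^+ N = (map_poly C E).[x] ->
  biv_eval C u z a = 0 -> biv_eval C x y a = 0.
Proof.
move=> yN; pose P : {poly {poly k}} := 'X^N - E%:P.
have Pm : P \is monic by apply: monicXnsubC.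
have PE x' y' : y' ^+ N = (map_poly C E).[x'] -> biv_eval C x' y' P = 0.
  by move=> y'N; rewrite rmorphB rmorphXn biv_evalX biv_evalC y'N subrr.
have uP : z ^+ N = (map_poly C E).[u] by rewrite horner_ratvar.
rewrite (Pdiv.RingMonic.rdivp_eq Pm a) !rmorphD !rmorphM !PE // !mulr0 !add0r.
rewrite biv_eval_ratvar => /(radical_free E_neq0 mupE zN) -> //.
  by rewrite rmorph0.
by rewrite -ltnS -(size_XnsubC E N_gt0) Pdiv.Ring.ltn_rmodpN0 ?monic_neq0.
Qed.

Lemma biv_eval_frac x :
  exists a p, p != 0 /\ x * (map_poly C p).[u] = biv_eval C u z a.
Proof.
have : x \in <<1; z>>%VS by rewrite F_gen memvf.
case/Fadjoin1_polyP => P ->; elim/poly_ind: P => [|P c [a [p [p0 IHp]]]].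
  by exists 0, 1; rewrite oner_neq0 !rmorph0 horner0 mul0r.
have -> : (map_poly (in_alg F) (P * 'X + c%:P)).[z] =
    (map_poly (in_alg F) P).[z] * z + in_alg F c by apply: horner_map_MXaddC.
have [r [s [s0 c_def]]] := fraction_divP c.
have cs : in_alg F c * (tofrac s)%:A = (tofrac r)%:A.
  rewrite -[(tofrac s)%:A]/(in_alg F (tofrac s)) -rmorphM c_def divfK //.
  by rewrite tofrac_eq0.
(* The sum of [(a / p) * z] and [c = r / s], over the common denominator [p * s]. *)
exists (a * 'X * s%:P + (r * p)%:P), (p * s); split; first by rewrite mulf_neq0.
rewrite !(rmorphD, rmorphM) !biv_evalC biv_evalX -IHp !hornerM !horner_ratvar.
rewrite -cs; move: (in_alg F c) (tofrac s)%:A (tofrac p)%:A => c1 s1 p1.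
ring.
Qed.

(** Relations persist at [(x, y)] by [biv_eval_specialize], and transcendence of [x] keeps the
    denominators of [biv_eval_frac] nonzero. *)
Lemma radical_hom_exists x y :
    y ^+ N = (map_poly C E).[x] -> (forall p, p != 0 -> (map_poly C p).[x] != 0) ->
  exists s : F -> F, [/\ zmod_morphism s, monoid_morphism s,
    forall c, s (C c) = C c, s u = x & s z = y].
Proof.
move=> yN xtr.
have [||s [sB sM sE]] := @rmorph_extend_frac _ _ _ (biv_eval C u z) (biv_eval C x y).
- by move=> a; apply: biv_eval_specialize.
- move=> w; have [a [p [p0 wp]]] := biv_eval_frac w.
  by exists a, p%:P; rewrite !biv_evalC wp xtr.
exists s; split=> //.
- move=> c; have := sE c%:P%:P; rewrite !biv_evalC !map_polyC /= !hornerC.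
  by [].
- have := sE 'X%:P; rewrite !biv_evalC !map_polyX !hornerX.
  by [].
- have := sE 'X; rewrite !biv_evalX.
  by [].
Qed.

Lemma radical_hom_unique (s t : F -> F) :
    zmod_morphism s -> monoid_morphism s -> (forall c, s (C c) = C c) ->
    zmod_morphism t -> monoid_morphism t -> (forall c, t (C c) = C c) ->
  s u = t u -> s z = t z -> s =1 t.
Proof.
move=> sB sM sC tB tM tC su sz x; have [a [p [p0 xp]]] := biv_eval_frac x.
have st b : s (biv_eval C u z b) = t (biv_eval C u z b).
  by rewrite !biv_eval_rmorph // su sz.
have pu := ratvar_transcendental p0.
(* [t] is unbundled, so its injectivity is checked by hand: it sends a unit to a unit. *)
have : t (map_poly C p).[u] != 0.
  apply: contraTneq isT => tp0.
  have := tM.2 (map_poly C p).[u] (map_poly C p).[u]^-1.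
  by rewrite divff // tp0 mul0r tM.1 => /eqP; rewrite oner_eq0.
move/mulIf; apply.
have sp : s (map_poly C p).[u] = t (map_poly C p).[u].
  by have := st p%:P; rewrite !biv_evalC.
by rewrite -{1}sp -sM.2 -tM.2 xp.
Qed.
End RadicalExtension.

(** * Moebius transformations of the curve equation *)

Section CurvePolynomial.
Variables (k : fieldType) (q m : nat) (c : k).

Definition curve_poly : {poly k} :=
  c%:P * ('X^q - 'X) * (1 + ('X^q - 'X) ^+ (q - 1)) ^+ m.

Lemma horner_map_curve_poly (F : fieldType) (C : {rmorphism k -> F}) x :
  (map_poly C curve_poly).[x] =
    C c * (x ^+ q - x) * (1 + (x ^+ q - x) ^+ (q - 1)) ^+ m.
Proof.
rewrite !(rmorphM, rmorphXn, rmorphD, rmorphN, rmorph1) /= map_polyC map_polyX.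
by rewrite !(hornerE, horner_exp).
Qed.

(** [X] splits off from [X^q - X], and the cofactor [G] takes the value [-c] at 0. *)
Lemma mup_curve_poly : (1 < q)%N -> c != 0 ->
  curve_poly != 0 /\ mup 0 curve_poly = 1%N.
Proof.
move=> q_gt1 c0.
pose G : {poly k} := c%:P * ('X^(q - 1) - 1) * (1 + ('X^q - 'X) ^+ (q - 1)) ^+ m.
have z1 : 0 ^+ (q - 1) = 0 :> k by case: q q_gt1 => [|[|r]] // _; rewrite exprS mul0r.
have z0 : 0 ^+ q = 0 :> k by case: q q_gt1 => [|r] // _; rewrite exprS mul0r.
have EG : curve_poly = ('X - 0%:P) ^+ 1 * G.
  rewrite /G /curve_poly.
  have -> : 'X^q - 'X = 'X * ('X^(q - 1) - 1) :> {poly k}.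
    by rewrite mulrBr mulr1 -exprS subn1 prednK // ltnW.
  by rewrite expr1 subr0 !mulrA [c%:P * 'X]mulrC.
have G0 : ~~ root G 0.
  rewrite /root /G !(hornerE, horner_exp) z0 subr0 z1 addr0 expr1n mulr1 sub0r.
  by rewrite mulrN1 oppr_eq0.
have Gn0 : G != 0 by apply: contraNneq G0 => ->; rewrite root0.
by rewrite EG mulf_neq0 ?expf_neq0 ?polyXsubC_eq0 // mupMl // mup_XsubCX eqxx.
Qed.
End CurvePolynomial.

Section MoebiusInvariance.
Variables (F : fieldType) (al be ga de x : F).
Hypothesis D0 : ga * x + de != 0.

(** The [Q]-power map is additive and fixes the coefficients, so [y ^+ Q] is the same Moebius map at
    [x ^+ Q]; over a common denominator only the determinant terms remain. *)
Lemma moebius_frob (Q : nat) : [pchar F].-nat Q ->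
    al ^+ Q = al -> be ^+ Q = be -> ga ^+ Q = ga -> de ^+ Q = de ->
  let y := (al * x + be) / (ga * x + de) in
  y ^+ Q - y = (al * de - be * ga) * (x ^+ Q - x) / (ga * x + de) ^+ Q.+1.
Proof.
move=> pQ alQ beQ gaQ deQ /=.
have: (ga * x + de) ^+ Q != 0 by rewrite expf_neq0.
rewrite exprS expr_div_n !exprDn_pchar // !exprMn alQ beQ gaQ deQ => DQ.
by field; rewrite DQ D0.
Qed.

Variable q : nat.
Hypotheses (q_gt1 : (1 < q)%N) (q_pchar : [pchar F].-nat q).
Hypotheses (alq : al ^+ q = al) (beq : be ^+ q = be).
Hypotheses (gaq : ga ^+ q = ga) (deq : de ^+ q = de).
Hypotheses (det0 : al * de - be * ga != 0) (w0 : x ^+ q - x != 0).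

(** With [w = y ^+ q - y], the product [w * (1 + w ^+ (q - 1)) = w + w ^+ q] telescopes to
    [y ^+ (q * q) - y]. *)
Lemma curve_factor (y : F) : y ^+ q - y != 0 ->
  1 + (y ^+ q - y) ^+ (q - 1) = (y ^+ (q * q) - y) / (y ^+ q - y).
Proof.
move=> y0; apply: (mulIf y0); rewrite divfK // mulrDl mul1r -exprSr subn1.
rewrite prednK ?(ltnW q_gt1) // exprDn_pchar // exprNn_pchar // -exprM.
by rewrite addrC subrKA.
Qed.

(** In the quotient of [curve_factor] the determinants cancel and the denominator is left to the
    power [q * q - q]; the determinant on the right comes from [y ^+ q - y] alone. *)
Lemma moebius_curve m (c : F) (y := (al * x + be) / (ga * x + de)) :
  c * (y ^+ q - y) * (1 + (y ^+ q - y) ^+ (q - 1)) ^+ m =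
  (al * de - be * ga) * (c * (x ^+ q - x) * (1 + (x ^+ q - x) ^+ (q - 1)) ^+ m)
    / (ga * x + de) ^+ (q.+1 + (q * q - q) * m).
Proof.
have yq : y ^+ q - y = _ := moebius_frob q_pchar alq beq gaq deq.
have yqq : y ^+ (q * q) - y =
    (al * de - be * ga) * (x ^+ (q * q) - x) / (ga * x + de) ^+ (q * q).+1.
  by apply: moebius_frob; rewrite ?pnatM ?q_pchar // exprM ?alq ?beq ?gaq ?deq.
have y0 : y ^+ q - y != 0.
  by rewrite yq !mulf_neq0 ?invr_eq0 ?expf_neq0.
rewrite !curve_factor // yqq yq exprD (exprM _ (q * q - q)%N).
have -> : (q * q).+1 = (q.+1 + (q * q - q))%N.
  by rewrite addSn subnKC // leq_pmulr // ltnW.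
have -> : (al * de - be * ga) * (x ^+ (q * q) - x) /
      (ga * x + de) ^+ (q.+1 + (q * q - q)) /
      ((al * de - be * ga) * (x ^+ q - x) / (ga * x + de) ^+ q.+1) =
    (x ^+ (q * q) - x) / (x ^+ q - x) / (ga * x + de) ^+ (q * q - q).
  rewrite exprD; have A := expf_neq0 q.+1 D0.
  have B := expf_neq0 (q * q - q) D0; move: A B w0 det0.
  move: (_ ^+ q.+1) (_ ^+ (q * q - q)) (x ^+ q - x) (al * de - _) => A B w d.
  by move=> A0 B0 wn0 d0; field; rewrite A0 B0 wn0 d0.
rewrite expr_div_n.
have A := expf_neq0 q.+1 D0.
have B := expf_neq0 m (expf_neq0 (q * q - q) D0); move: A B.
move: (_ ^+ q.+1) ((_ ^+ (q * q - q)) ^+ m) (((_ - x) / _) ^+ m) => A B r A0 B0.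
by field; rewrite A0 B0.
Qed.
End MoebiusInvariance.

(** * Counting *)

Section FiniteFieldPowers.
Variable K : finFieldType.

(** [X^N - a] divides [X^(N M) - a^M = X^(|K| - 1) - 1], hence the product of all [X - x]; it
    therefore splits with [N] distinct roots. *)
Lemma card_power_fibre (N M : nat) (a : K) : (0 < N)%N -> (N * M = #|K|.-1)%N ->
  a ^+ M = 1 -> #|[set x : K | x ^+ N == a]| = N.
Proof.
move=> N0 NM aM.
have : 'X^N - a%:P %| \prod_(x <- enum K) ('X - x%:P).
  rewrite big_enum /= -finField_genPoly.
  have -> : 'X^#|K| - 'X = 'X * ('X^N ^+ M - a%:P ^+ M) :> {poly K}.
    rewrite -exprM NM -rmorphXn aM /= mulrBr mulr1 -exprS prednK //.
    by rewrite ltnW ?finNzRing_gt1.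
  by rewrite subrXX dvdp_mull // dvdp_mulr.
case/dvdp_prod_XsubC => m; rewrite eqp_monic ?monic_prod_XsubC ?monicXnsubC //.
move/eqP => Pm; set s := mask m (enum K) in Pm.
have us : uniq s by rewrite mask_uniq ?enum_uniq.
have ss : size s = N.
  by apply: succn_inj; rewrite -(size_prod_XsubC s id) -Pm size_XnsubC.
rewrite -[RHS]ss -(card_uniqP us); apply: eq_card => x.
rewrite inE -root_prod_XsubC -Pm /root !hornerE.
by rewrite subr_eq0.
Qed.
End FiniteFieldPowers.

(** The fibres partition [D] into blocks of size [d], so there are [m] of them, and enumerating the
    blocks enumerates the image. *)
Lemma card_eq_image_fibres (T : finType) (U : choiceType) (f : T -> U)
    (D : {set T}) (d m : nat) : (0 < d)%N ->
    {in D, forall x, #|[set y in D | f x == f y]| = d} -> #|D| = (d * m)%N ->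
  ((f @` [set` D])%classic #= `I_m)%card.
Proof.
move=> d0 fib cD; pose P := preim_partition f D.
have Pfib B : B \in P -> exists2 x, x \in D & B = [set y in D | f x == f y].
  by case/imsetP => x xD ->; exists x.
have cP : #|P| = m.
  apply/eqP; rewrite -(eqn_pmul2l d0) -cD mulnC; apply/eqP/esym.
  apply: card_uniform_partition (preim_partitionP f D) => B /Pfib[x xD ->].
  exact: fib.
have [D0|[x0 x0D]] := set_0Vmem D.
  have m0 : m = 0%N.
    by apply/eqP; move/eqP: cD; rewrite D0 cards0 eq_sym muln_eq0 eqn0Ngt d0.
  rewrite m0 II0 (_ : (f @` _)%classic = set0) ?card_eqxx //.
  by apply/seteqP; split => // y [x]; rewrite /= D0 inE.
(* The value of [f] on the [i]-th block; blocks are nonempty, so the default [x0] is not reached for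
   [i < m]. *)
pose g i := f (odflt x0 [pick x in nth finset.set0 (enum P) i]).
have gP i x : (i < m)%N -> x \in nth finset.set0 (enum P) i -> g i = f x.
  move=> im; have : nth finset.set0 (enum P) i \in P.
    by rewrite -mem_enum mem_nth // -cardE cP.
  case/Pfib => w wD; rewrite /g => ->; rewrite inE => /andP[_ /eqP<-].
  case: pickP => [y|/(_ w)]; first by rewrite inE => /andP[_ /eqP].
  by rewrite inE wD eqxx.
have -> : (f @` [set` D])%classic = (g @` `I_m)%classic.
  apply/seteqP; split => [_ [x xD <-]|_ [i /= im <-]].
    have xcP : x \in finset.cover P by rewrite (cover_partition (preim_partitionP f D)).
    have BP : finset.pblock P x \in P by rewrite pblock_mem.
    exists (index (finset.pblock P x) (enum P)) => /=.
      by rewrite -cP cardE index_mem mem_enum.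
    apply: gP; first by rewrite -cP cardE index_mem mem_enum.
    by rewrite nth_index ?mem_enum // mem_pblock.
  have : nth finset.set0 (enum P) i \in P by rewrite -mem_enum mem_nth // -cardE cP.
  case/Pfib => x xD Bx; exists x => //; apply/esym/gP => //.
  by rewrite Bx inE xD eqxx.
apply: inj_card_eq => i l; rewrite !inE /= => im lm gil.
have iP : nth finset.set0 (enum P) i \in P by rewrite -mem_enum mem_nth // -cardE cP.
have lP : nth finset.set0 (enum P) l \in P by rewrite -mem_enum mem_nth // -cardE cP.
apply/eqP; rewrite -(nth_uniq finset.set0 (s := enum P)) ?enum_uniq -?cardE ?cP //.
have [x xD Bx] := Pfib _ iP; have [y yD By] := Pfib _ lP.
have fxy : f x = f y.
  by rewrite -(gP i x) ?Bx ?inE ?xD ?eqxx // gil (gP l y) ?By ?inE ?yD ?eqxx.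
by rewrite Bx By fxy.
Qed.

(** * The automorphisms [sigma_(M, lambda)] *)

Lemma det_mx22 (R : comNzRingType) (A : 'M[R]_2) :
  \det A = A 0 0 * A 1 1 - A 0 1 * A 1 0.
Proof.
rewrite (expand_det_row _ 0) !big_ord_recl big_ord0 addr0 /cofactor !det_mx11 !mxE.
have -> : lift 0 0 = 1 :> 'I_2 by apply/val_inj.
have -> : lift 1 0 = 0 :> 'I_2 by apply/val_inj.
by rewrite /= expr0 expr1 mul1r mulN1r mulrN.
Qed.

Lemma mulmx22 (R : nzSemiRingType) (A B : 'M[R]_2) i h :
  (A *m B) i h = A i 0 * B 0 h + A i 1 * B 1 h.
Proof.
rewrite mxE !big_ord_recl big_ord0 addr0.
by have -> : lift ord0 ord0 = 1 :> 'I_2 by apply/val_inj.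
Qed.

(** The adjugate matrix undoes the Moebius map. *)
Lemma moebius_inv (K : fieldType) (a b g d x : K) :
    g * x + d != 0 -> a * d - b * g != 0 ->
  let y := (a * x + b) / (g * x + d) in (d * y - b) / (a - g * y) = x.
Proof.
move=> D0 det0 y; have Dy : a - g * y = (a * d - b * g) / (g * x + d).
  by rewrite /y; field.
by rewrite Dy /y; field; rewrite det0 D0.
Qed.

(** Cocycle rule: the denominator of the product matrix at [x] is [(g' * y + d') * (g * x + d)]. *)
Lemma moebius_comp (K : fieldType) (a b g d g' d' x a' b' l l' z : K)
    (y := (a * x + b) / (g * x + d)) :
    g * x + d != 0 -> (g' * a + d' * g) * x + (g' * b + d' * d) != 0 ->
  (a' * y + b') / (g' * y + d') =
    ((a' * a + b' * g) * x + (a' * b + b' * d)) /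
      ((g' * a + d' * g) * x + (g' * b + d' * d)) /\
  l' * (l * z / (g * x + d)) / (g' * y + d') =
    l * l' * z / ((g' * a + d' * g) * x + (g' * b + d' * d)).
Proof.
move=> D0 D'0.
have Dy : g' * y + d' =
    ((g' * a + d' * g) * x + (g' * b + d' * d)) / (g * x + d).
  by rewrite /y; field.
by rewrite Dy /y; split; field; rewrite D0 D'0.
Qed.

Lemma moebius_scale (K : fieldType) (g d x a b l z t : K) :
    g * x + d != 0 -> t != 0 ->
  (t * a * x + t * b) / (t * g * x + t * d) = (a * x + b) / (g * x + d) /\
  t * l * z / (t * g * x + t * d) = l * z / (g * x + d).
Proof.
move=> D0 t0; have -> : t * g * x + t * d = t * (g * x + d) by ring.
by split; field; rewrite D0 t0.
Qed.

Lemma ord2P (i : 'I_2) : i = 0 \/ i = 1.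
Proof. by case: i => [[|[|//]] i2]; [left | right]; apply: val_inj. Qed.

(** * Moebius maps applied to the transcendental [u] *)

Section MoebiusLifts.
Variables (k : finFieldType) (F : fieldExtType {fraction {poly k}}).

Local Notation C := (constF F).
Local Notation u := (ratvar F).

Definition kend (s : F -> F) :=
  [/\ zmod_morphism s, monoid_morphism s & forall a, s (C a) = C a].

Lemma kend_comp s t : kend s -> kend t -> kend (s \o t).
Proof.
move=> [sB [s1 sM] sC] [tB [t1 tM] tC]; split=> [x y||a] /=.
- by rewrite tB sB.
- by split=> [|x y] /=; rewrite ?t1 ?s1 ?tM ?sM.
- by rewrite tC sC.
Qed.

Lemma kend_moebius (s : F -> F) a b g d x y : kend s ->
    s ((C a * x + C b) / (C g * x + C d)) = (C a * s x + C b) / (C g * s x + C d)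
  /\ s (C a * y / (C g * x + C d)) = C a * s y / (C g * s x + C d).
Proof.
move=> [sB sM sC].
pose sZ := GRing.isZmodMorphism.Build _ _ s sB.
pose sm := GRing.isMonoidMorphism.Build _ _ s sM.
pose S : {rmorphism F -> F} := HB.pack s sZ sm.
rewrite -![s _]/(S _) !(rmorphM, fmorphV, rmorphD) /=.
by rewrite !sC.
Qed.

Lemma ratvar_free a b : C a * u + C b = 0 -> a = 0 /\ b = 0.
Proof.
move=> ab0; have ab : a *: 'X + b%:P == 0 :> {poly k}.
  apply: contraTT isT => /(ratvar_transcendental F); rewrite -mul_polyC.
  by rewrite horner_map_MXaddC map_polyC hornerC ab0 eqxx.
have := congr1 (fun p : {poly k} => (p`_0, p`_1)) (eqP ab).
rewrite !coef0 !coefD !coefZ !coefX !coefC /= mulr0 mulr1 add0r addr0.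
by case=> -> ->.
Qed.

Lemma moebius_den_neq0 a b g d : a * d - b * g != 0 -> C g * u + C d != 0.
Proof.
move=> det0; apply: contraNneq det0 => /ratvar_free[-> ->].
by rewrite !mulr0 subr0.
Qed.

(** By [moebius_inv], [u] is a rational expression in its Moebius image, so algebraicity of the
    image would pass to [u]. *)
Lemma moebius_transcendental a b g d (p : {poly k}) :
    a * d - b * g != 0 -> p != 0 ->
  (map_poly C p).[(C a * u + C b) / (C g * u + C d)] != 0.
Proof.
move=> det0 p0; apply/negP => py0.
pose y := (C a * u + C b) / (C g * u + C d).
have : algebraicOver C y by exists p; rewrite // rootE.
have D0 := moebius_den_neq0 det0.
have detC : C a * C d - C b * C g != 0.
  by rewrite -!rmorphM -rmorphB fmorph_eq0.
move=> yalg.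
have uy : (C d * y - C b) / (C a - C g * y) = u by exact: moebius_inv.
have [] : algebraicOver C u.
  rewrite -uy; have Ca := algebraic_id C.
  by apply: algebraic_div; apply: algebraic_sub => //; apply: algebraic_mul.
move=> r /(ratvar_transcendental F) r0 /eqP ru.
by rewrite ru eqxx in r0.
Qed.

(** The images of [z] give the ratio [t] of the denominators, then the images of [u] give the same
    ratio for the numerators; coefficients are compared by [ratvar_free]. *)
Lemma moebius_lift_eq a b g d a' b' g' d' l l' (z : F) : z != 0 -> l != 0 ->
    a * d - b * g != 0 -> a' * d' - b' * g' != 0 ->
    (C a * u + C b) / (C g * u + C d) = (C a' * u + C b') / (C g' * u + C d') ->
    C l * z / (C g * u + C d) = C l' * z / (C g' * u + C d') ->
  let t := l' / l in [/\ a' = t * a, b' = t * b, g' = t * g & d' = t * d].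
Proof.
move=> z0 l0 /moebius_den_neq0 D0 /moebius_den_neq0 D'0 Hu Hz t.
have lift r x y x' y' : C x' * u + C y' = C r * (C x * u + C y) ->
    x' = r * x /\ y' = r * y.
  move=> xy; have [|xt0 yt0] := @ratvar_free (x' - r * x) (y' - r * y).
    by rewrite !rmorphB !rmorphM mulrBl addrACA -opprD xy mulrDr mulrA subrr.
  by split; apply/eqP; rewrite -subr_eq0 ?xt0 ?yt0.
have D'D : C g' * u + C d' = C t * (C g * u + C d).
  move/eqP: Hz; rewrite eqr_div // ![_ * z]mulrC -!mulrA (inj_eq (mulfI z0)) => /eqP e.
  apply: (@mulfI _ (C l)); first by rewrite fmorph_eq0.
  by rewrite e mulrA -rmorphM /t mulrCA divff // mulr1.
have A'A : C a' * u + C b' = C t * (C a * u + C b).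
  move/eqP: Hu; rewrite eqr_div // D'D mulrA (inj_eq (mulIf D0)) => /eqP <-.
  by rewrite mulrC.
by have [-> ->] := lift _ _ _ _ _ D'D; have [-> ->] := lift _ _ _ _ _ A'A.
Qed.
End MoebiusLifts.

Section Sigmas.
Variables (p e q n : nat).
Hypotheses (p_prime : prime p) (q_def : q = (p ^ e)%N).
Hypothesis (n_gt0 : (0 < n)%N).
Variables (k Fq : finFieldType) (j : {rmorphism Fq -> k}) (c : k).
Hypotheses (card_Fq : #|Fq| = q) (c_neq0 : c != 0).
Variables (F : fieldExtType {fraction {poly k}}) (z : F).
Hypotheses (F_gen : <<1; z>>%VS = fullv) (z_eq : curve_eq q n c z).

Local Notation C := (constF F).
Local Notation u := (ratvar F).
Let m := ((q ^ (n - 1) - 1) %/ (q - 1))%N.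
Let E := curve_poly q m c.

(* [sigma_spec] for an unbundled function: bijectivity of the lift of [M] is
   only available once the lift of [M^-1] has been constructed. *)
Definition lift_spec (M : {'GL_2[Fq]}) (l : k) (s : F -> F) : Prop :=
  s u = (C (j (GLval M 0 0)) * u + C (j (GLval M 0 1)))
          / (C (j (GLval M 1 0)) * u + C (j (GLval M 1 1)))
  /\ s z = C l * z / (C (j (GLval M 1 0)) * u + C (j (GLval M 1 1))).

Lemma q_gt1 : (1 < q)%N.
Proof. by rewrite -card_Fq finNzRing_gt1. Qed.

Lemma expf_cardX h (x : Fq) : x ^+ (q ^ h) = x.
Proof.
elim: h => [|h IHh]; first by rewrite expr1.
by rewrite expnSr exprM IHh -card_Fq expf_card.
Qed.

(** Since [m * (q - 1) = q ^ (n - 1) - 1], the product [(q * q - q) * m] is [q ^ n - q]; the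
    denominator in [moebius_curve] thus has the exponent that [z] has in the curve equation. *)
Lemma curve_exponent : (q.+1 + (q * q - q) * m = q ^ n + 1)%N.
Proof.
have q1 : (0 < q - 1)%N by rewrite subn_gt0 q_gt1.
have mE : (m * (q - 1) = q ^ (n - 1) - 1)%N.
  by rewrite divnK // !subn1 dvdn_pred_predX.
rewrite -{4}[q]muln1 -mulnBr -mulnA [(_ * m)%N]mulnC mE mulnBr muln1.
rewrite -expnS subn1 prednK // addSn subnKC ?addn1 //.
by rewrite -{1}[q]expn1 leq_exp2l // q_gt1.
Qed.

Lemma z_root : z ^+ (q ^ n + 1) = (map_poly C E).[u].
Proof. by rewrite horner_map_curve_poly. Qed.

Lemma z_radical : z ^+ (q ^ n + 1) = (tofrac E)%:A.
Proof. by rewrite z_root horner_ratvar. Qed.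

Lemma z_neq0 : z != 0.
Proof.
have [E0 _] := mup_curve_poly m q_gt1 c_neq0.
by apply: contraTneq (ratvar_transcendental F E0) => z0;
   rewrite -z_root z0 addn1 exprS mul0r negbK.
Qed.

Lemma GL_det_entries (M : {'GL_2[Fq]}) :
  j (GLval M 0 0) * j (GLval M 1 1) - j (GLval M 0 1) * j (GLval M 1 0)
    = j (\det (GLval M)).
Proof. by rewrite det_mx22 rmorphB !rmorphM. Qed.

Lemma GL_det_neq0 (M : {'GL_2[Fq]}) :
  j (GLval M 0 0) * j (GLval M 1 1) - j (GLval M 0 1) * j (GLval M 1 0) != 0.
Proof. by rewrite GL_det_entries fmorph_eq0 GL_det. Qed.

Lemma lift_exists M l : sigma_param j q n M l ->
  exists2 s : F -> F, kend s & lift_spec M l s.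
Proof.
move=> [l0 lN]; have [E0 mupE] := mup_curve_poly m q_gt1 c_neq0.
have det0 := GL_det_neq0 M; have D0 := moebius_den_neq0 F det0.
have entryq x : C (j x) ^+ q = C (j x) by rewrite -!rmorphXn -card_Fq expf_card.
(* The characteristic passes from [Fq] to [k] and to [F] along the embeddings. *)
have q_pchar : [pchar F].-nat q.
  rewrite q_def pnatX pnatE // (rmorph_pchar C) // (rmorph_pchar j) //.
  by apply: (card_finPcharP (n := e)); rewrite ?card_Fq.
have det0F : C (j (GLval M 0 0)) * C (j (GLval M 1 1))
    - C (j (GLval M 0 1)) * C (j (GLval M 1 0)) != 0.
  by have := det0; rewrite -(fmorph_eq0 C) rmorphB !rmorphM.
have w0 : u ^+ q - u != 0.
  have: 'X^q - 'X != 0 :> {poly k}.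
    rewrite -size_poly_eq0 size_polyDl ?size_polyXn // size_polyN size_polyX.
    by rewrite ltnS q_gt1.
  by move/(ratvar_transcendental F); rewrite rmorphB /= map_polyXn map_polyX !hornerE.
pose y := C l * z / (C (j (GLval M 1 0)) * u + C (j (GLval M 1 1))).
(* The proposed image of [(u, z)] lies on the curve: [l ^+ (q ^ n + 1)] supplies the determinant
   produced by [moebius_curve]. *)
have yN : y ^+ (q ^ n + 1) = (map_poly C E).[
    (C (j (GLval M 0 0)) * u + C (j (GLval M 0 1)))
      / (C (j (GLval M 1 0)) * u + C (j (GLval M 1 1)))].
  rewrite horner_map_curve_poly moebius_curve ?entryq ?q_gt1 //.
  rewrite curve_exponent expr_div_n exprMn z_root horner_map_curve_poly.
  by rewrite -rmorphXn lN -GL_det_entries rmorphB !rmorphM.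
have N0 : (0 < q ^ n + 1)%N by rewrite addn1.
have [s [sB sM sC su sz]] := radical_hom_exists E0 mupE N0 F_gen z_radical yN
  (fun r => moebius_transcendental F (p := r) det0).
by exists s.
Qed.

Lemma lift_spec_unique M l s t : kend s -> kend t ->
  lift_spec M l s -> lift_spec M l t -> s =1 t.
Proof.
move=> [sB sM sC] [tB tM tC] [su sz] [tu tz].
by apply: (radical_hom_unique F_gen sB sM sC tB tM tC); rewrite ?su ?sz.
Qed.

(** [s] fixes the coefficients of [t u], so [M] is substituted into [M']: matrices multiply in the
    order opposite to composition. *)
Lemma lift_spec_comp M l s M' l' t : kend s -> kend t ->
  lift_spec M l s -> lift_spec M' l' t -> lift_spec (M' * M)%g (l * l') (s \o t).
Proof.
move=> sK tK [su sz] [tu tz].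
have D0 := moebius_den_neq0 F (GL_det_neq0 M).
have D0' := moebius_den_neq0 F (GL_det_neq0 (M' * M)%g).
have entryM i h : C (j (GLval (M' * M)%g i h)) =
    C (j (GLval M' i 0)) * C (j (GLval M 0 h)) +
    C (j (GLval M' i 1)) * C (j (GLval M 1 h)).
  by rewrite GL_MxE mulmx22 !rmorphD !rmorphM.
rewrite !entryM in D0'.
have [E1 E2] := moebius_comp (C (j (GLval M' 0 0))) (C (j (GLval M' 0 1)))
  (C l) (C l') z D0 D0'.
rewrite /lift_spec -![(s \o t) _]/(s (t _)) tu tz !entryM (rmorphM C).
have [-> _] := kend_moebius (j (GLval M' 0 0)) (j (GLval M' 0 1))
  (j (GLval M' 1 0)) (j (GLval M' 1 1)) u z sK.
(* The 0 is a placeholder for [b], which occurs only in the first formula. *)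
have [_ ->] := kend_moebius l' 0 (j (GLval M' 1 0)) (j (GLval M' 1 1)) u z sK.
by rewrite su sz E1 E2.
Qed.

Lemma lift_spec1 : lift_spec 1%g 1 id.
Proof.
have entry1 i h : C (j (GLval 1%g i h)) = (i == h)%:R.
  by rewrite GL_1E -[1%R]/(1%:M) mxE !rmorph_nat.
rewrite /lift_spec !entry1 !eqxx ![(_ == _)%:R]/(0%:R) rmorph1.
by rewrite !mul1r mul0r addr0 add0r !divr1.
Qed.

(** * Inverses and the subgroup property *)

Lemma sigma_paramM M l M' l' : sigma_param j q n M l -> sigma_param j q n M' l' ->
  sigma_param j q n (M' * M)%g (l * l').
Proof.
move=> [l0 lN] [l'0 l'N]; split; first by rewrite mulf_neq0.
by rewrite exprMn lN l'N GL_MxE det_mulmx rmorphM mulrC.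
Qed.

Lemma sigma_paramV M l : sigma_param j q n M l -> sigma_param j q n M^-1%g l^-1.
Proof.
move=> [l0 lN]; split; first by rewrite invr_eq0.
by rewrite exprVn lN GL_VxE det_inv fmorphV.
Qed.

(** The lifts of [(M, l)] and [(M^-1, l^-1)] compose both ways to a lift of [(1, 1)], which is the
    identity by uniqueness; this gives bijectivity. *)
Lemma sigma_exists M l : sigma_param j q n M l ->
  exists s : kaut C, lift_spec M l s.
Proof.
move=> Ml; have [l0 _] := Ml.
have [s sK sM] := lift_exists Ml; have [t tK tM] := lift_exists (sigma_paramV Ml).
have idK : kend id by split.
have st : s \o t =1 id.
  apply: lift_spec_unique lift_spec1 => //; first exact: kend_comp.
  by rewrite -[1%g](mulVg M) -[1](mulfV l0); apply: lift_spec_comp.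
have ts : t \o s =1 id.
  apply: lift_spec_unique lift_spec1 => //; first exact: kend_comp.
  by rewrite -[1%g](mulgV M) -[1](mulVf l0); apply: lift_spec_comp.
have sP : is_kaut C s by case: sK => sB sM' sC; split => //; exists t.
by exists (KAut (asboolT sP)).
Qed.

Lemma kaut_kend (s : kaut C) : kend s.
Proof. by have [] := kautP s. Qed.

Lemma sigma_unique M l (s t : kaut C) : lift_spec M l s -> lift_spec M l t -> s = t.
Proof.
by move=> sM tM; apply/kaut_eqP/(lift_spec_unique _ _ sM tM); apply: kaut_kend.
Qed.

Lemma sigmaV M l (s : kaut C) : sigma_param j q n M l -> lift_spec M l s ->
  lift_spec M^-1%g l^-1 (s^-1)%g.
Proof.
move=> Ml sM; have [t tM] := sigma_exists (sigma_paramV Ml).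
suff /mulg1_eq -> : (s * t = 1)%g by [].
apply/(@sigma_unique 1%g 1); last exact: lift_spec1.
have [l0 _] := Ml; rewrite -[1%g](mulVg M) -[1](mulfV l0).
by apply: lift_spec_comp => //; apply: kaut_kend.
Qed.

Lemma group_closed_sigmas : group_closed [in sigmas j q n z].
Proof.
split.
  rewrite inE; exists 1%g, 1; split; last exact: lift_spec1.
  by split; [exact: oner_neq0 | rewrite expr1n GL_1E det1 rmorph1].
move=> s t; rewrite !inE => -[M [l [Ml sM]]] [M' [l' [Ml' tM]]].
(* Parameters of the quotient of [s] by [t], with the matrices in reversed order. *)
exists (M'^-1 * M)%g, (l * l'^-1); split; first exact/sigma_paramM/sigma_paramV.
apply: lift_spec_comp (sigmaV Ml' tM) => //; exact: kaut_kend.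
Qed.

(** * Fibres of the parametrization and the order of the group *)

Definition sigma_of (x : {'GL_2[Fq]} * k) : kaut C :=
  xget 1%g [set s : kaut C | lift_spec x.1 x.2 s]%classic.

Definition sigma_params : {set {'GL_2[Fq]} * k} :=
  [set x | (x.2 != 0) && (x.2 ^+ (q ^ n + 1) == j (\det (GLval x.1)))].

Lemma sigma_paramsP x : reflect (sigma_param j q n x.1 x.2) (x \in sigma_params).
Proof.
by rewrite inE; apply: (iffP andP) => [[? /eqP]|[? ->]].
Qed.

Lemma sigma_ofP x : x \in sigma_params -> lift_spec x.1 x.2 (sigma_of x).
Proof.
move/sigma_paramsP/sigma_exists => [s sx].
by rewrite /sigma_of; case: xgetP => // /(_ s).
Qed.

Lemma sigmas_image : sigmas j q n z = (sigma_of @` [set` sigma_params])%classic.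
Proof.
apply/seteqP; split=> s.
  move=> [M [l [Ml sM]]]; have xP : (M, l) \in sigma_params by apply/sigma_paramsP.
  by exists (M, l) => //; apply: (sigma_unique _ sM); apply: (sigma_ofP xP).
move=> [x xP <-]; exists x.1, x.2; split; first exact/sigma_paramsP.
exact: sigma_ofP.
Qed.

(** [insubd] falls back to [x.1] when the scaled matrix is singular, that is, for [t = 0]. *)
Definition scale_param (x : {'GL_2[Fq]} * k) (t : Fq) : {'GL_2[Fq]} * k :=
  (insubd x.1 (t *: GLval x.1), j t * x.2).

Lemma scale_paramE x t : t != 0 ->
  GLval (scale_param x t).1 = t *: GLval x.1.
Proof.
move=> t0; rewrite insubdK // -topredE /= unitmxE detZ unitrM unitrX ?unitfE //.
by have := GL_det x.1.
Qed.

(** As [t ^+ (q ^ n) = t], the power of [j t * x.2] gains the factor [t ^+ 2], just as the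
    determinant does. *)
Lemma scale_param_in x t : x \in sigma_params -> t != 0 ->
  scale_param x t \in sigma_params.
Proof.
move=> /sigma_paramsP[l0 lN] t0; apply/sigma_paramsP; split.
  by rewrite mulf_neq0 ?fmorph_eq0.
have jq : j t ^+ (q ^ n) = j t.
  by rewrite -rmorphXn expf_cardX.
by rewrite scale_paramE //= exprMn lN exprD jq detZ rmorphM rmorphXn.
Qed.

(** One inclusion is [moebius_lift_eq], the other [moebius_scale]. *)
Lemma sigma_fibre x : x \in sigma_params ->
  [set y in sigma_params | sigma_of x == sigma_of y] =
    [set scale_param x t | t in [set~ 0]].
Proof.
move=> xP; have [l0 _] := sigma_paramsP _ xP.
have [xu xz] := sigma_ofP xP.
apply/setP => y; rewrite inE; apply/andP/imsetP.
  move=> [yP /eqP xy]; have [yu yz] := sigma_ofP yP.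
  rewrite -xy xu in yu; rewrite -xy xz in yz.
  have [ea eb eg ed] :=
    moebius_lift_eq z_neq0 l0 (GL_det_neq0 x.1) (GL_det_neq0 y.1) yu yz.
  (* The scalar is a priori in [k]; it comes from [Fq] as the ratio of two entries in a bottom row,
     which has a nonzero entry. *)
  have [r jr] : exists r, j r = y.2 / x.2.
    have [g0|g0] := eqVneq (GLval x.1 1 0) 0; last first.
      exists (GLval y.1 1 0 / GLval x.1 1 0).
      by rewrite fmorph_div eg mulfK // fmorph_eq0.
    exists (GLval y.1 1 1 / GLval x.1 1 1).
    rewrite fmorph_div ed mulfK //; apply: contraNneq (GL_det_neq0 x.1) => d0.
    by rewrite g0 d0 rmorph0 !mulr0 subr0.
  have r0 : r != 0.
    rewrite -(fmorph_eq0 j) jr mulf_neq0 ?invr_eq0 //.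
    by have [] := sigma_paramsP _ yP.
  exists r; first by rewrite !inE.
  rewrite -jr -!rmorphM in ea eb eg ed.
  rewrite [LHS]surjective_pairing [RHS]surjective_pairing; congr pair.
    apply: val_inj; rewrite /= -[RHS]/(GLval (scale_param x r).1) scale_paramE //.
    apply/matrixP => a b; rewrite mxE; apply: (fmorph_inj j).
    by case: (ord2P a) (ord2P b) => -> [] ->.
  by rewrite /= jr divfK.
move=> [t]; rewrite in_setC1 => t0 ->; have txP := scale_param_in xP t0.
split=> //; apply/eqP; have [yu yz] := sigma_ofP txP.
apply: (sigma_unique (sigma_ofP xP)).
have D0 := moebius_den_neq0 F (GL_det_neq0 x.1).
have jt0 : C (j t) != 0 by rewrite !fmorph_eq0.
have [eu ez] := moebius_scale (C (j (GLval x.1 0 0))) (C (j (GLval x.1 0 1)))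
  (C x.2) z D0 jt0.
split; first by rewrite yu scale_paramE // !mxE !rmorphM eu.
by rewrite yz scale_paramE // !mxE !rmorphM ez.
Qed.

Lemma card_sigma_fibre x : x \in sigma_params ->
  #|[set y in sigma_params | sigma_of x == sigma_of y]| = (q - 1)%N.
Proof.
move=> xP; have [l0 _] := sigma_paramsP _ xP.
rewrite sigma_fibre // card_imset ?cardsC1 ?card_Fq ?subn1 //.
by move=> t t' [_ /(mulIf l0)/fmorph_inj].
Qed.

Hypothesis card_k : #|k| = (q ^ (2 * n))%N.

(** For each [M], the determinant comes from [Fq], so its power [q ^ n - 1] is 1 and
    [card_power_fibre] gives [q ^ n + 1] values of [l]. *)
Lemma card_sigma_params :
  #|sigma_params| = ((q - 1) * ((q ^ n + 1) * q * (q ^ 2 - 1)))%N.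
Proof.
have fibre (M : {'GL_2[Fq]}) :
    \sum_(l : k | (M, l) \in sigma_params) 1 = (q ^ n + 1)%N.
  have a0 : j (\det (GLval M)) != 0 by rewrite fmorph_eq0 GL_det.
  have NM : ((q ^ n + 1) * (q ^ n - 1) = #|k|.-1)%N.
    by rewrite card_k mulnC -subn_sqr exp1n mulnC expnM subn1.
  rewrite sum1dep_card -(card_power_fibre _ NM (a := j (\det (GLval M)))).
  (* A root [l] is nonzero because its power is the nonzero determinant. *)
  - apply: eq_card => l; rewrite !inE /=; apply: andb_idl.
    by apply: contraTneq => ->; rewrite addn1 exprS mul0r eq_sym.
  - by rewrite addn1.
  - apply: (mulfI a0); rewrite -exprS mulr1 subn1 (@prednK (q ^ n)).
      by rewrite -rmorphXn expf_cardX.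
    by rewrite expn_gt0 (ltnW q_gt1).
have -> : #|sigma_params| =
    (\sum_(M : {'GL_2[Fq]}) \sum_(l : k | (M, l) \in sigma_params) 1)%N.
  by rewrite pair_big_dep -sum1_card; apply: eq_bigl => -[M l].
rewrite (eq_bigr _ (fun M _ => fibre M)) sum_nat_const -cardsT card_GL_2 card_Fq.
rewrite -[in RHS](exp1n 2) subn_sqr subn1 addn1.
ring.
Qed.

Lemma card_sigmas : (sigmas j q n z #= `I_((q ^ n + 1) * q * (q ^ 2 - 1)))%card.
Proof.
rewrite sigmas_image; apply: card_eq_image_fibres card_sigma_params.
  by rewrite subn_gt0 q_gt1.
exact: card_sigma_fibre.
Qed.
End Sigmas.

Theorem proposition5p1 (p e q n : nat)
  (p_prime : prime p) (e_gt0 : (0 < e)%N) (q_def : q = (p ^ e)%N)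
  (n_ge4 : (4 <= n)%N)
  (k : finFieldType) (card_k : #|k| = (q ^ (2 * n))%N)
  (Fq : finFieldType) (card_Fq : #|Fq| = q) (j : {rmorphism Fq -> k})
  (c : k) (c_neq0 : c != 0) (c_pow : c ^+ (q ^ n) = - c)
  (F : fieldExtType {fraction {poly k}}) (z : F)
  (F_gen : <<1; z>>%VS = fullv) (z_eq : curve_eq q n c z) :
  [/\ forall (M : {'GL_2[Fq]}) (lambda : k), sigma_param j q n M lambda ->
        exists! s : kaut (constF F), sigma_spec j z M lambda s,
      group_closed [in sigmas j q n z]
    & (sigmas j q n z #= `I_((q ^ n + 1) * q * (q ^ 2 - 1)))%card].
Proof.
have n_gt0 : (0 < n)%N by apply: leq_trans n_ge4.
split.
- move=> M l Ml.
  have [s sM] := sigma_exists p_prime q_def n_gt0 card_Fq c_neq0 F_gen z_eq Ml.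
  exists s; split=> // t tM.
  exact: (sigma_unique F_gen sM tM).
- exact: (group_closed_sigmas p_prime q_def n_gt0 j card_Fq c_neq0 F_gen z_eq).
- exact: (card_sigmas p_prime q_def n_gt0 j card_Fq c_neq0 F_gen z_eq card_k).
Qed.
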